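(* Let $n, r, d \in \mathbb{N}$ with $r \geq 2$ and $d \geq 1$. Let $G$ be an $n$-vertex graph with minimum degree $\delta(G) \geq \left(\frac{1}{2}+\frac{1}{2r}\right)n + 6dr^2$. Then for every $r$-colouring of $E(G)$ there exists a Hamilton cycle in $G$ that is $d$-unbalanced, i.e. at least $n/r + d$ of its edges receive the same colour.
   Context: All graphs are finite and simple. An $r$-colouring of the edges of a graph is an arbitrary map assigning to each edge one of $r$ colours (not necessarily proper). For $t,r \in \mathbb{N}$ and a graph $H$, an $r$-colouring of the edges of $H$ is called $t$-unbalanced if at least $|E(H)|/r + t$ edges of $H$ have the same colour; a Hamilton cycle is $t$-unbalanced if the colouring restricted to it is $t$-unbalanced (a Hamilton cycle of an $n$-vertex graph has $n$ edges). *)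

(* Defs.v *)
From mathcomp Require Import all_boot all_order all_algebra.

Set Implicit Arguments.
Unset Strict Implicit.
Unset Printing Implicit Defensive.

Import GRing.Theory Num.Theory.
Local Open Scope ring_scope.

(* A finite simple graph is a symmetric irreflexive relation on a finType; its
   edges are the two-element sets [set x; y] with e x y. *)

Definition degree (T : finType) (e : rel T) (x : T) : nat := #|[set y | e x y]|.

(* #|T| exceeds every degree of an irreflexive relation, so for nonempty T the
   default value plays no role; the graph without vertices gets the value 0. *)
Definition min_degree (T : finType) (e : rel T) : nat :=
  (\big[minn/#|T|]_(x : T) degree e x)%N.

(* The sequence s lists the vertices of the cycle in cyclic order. The size
   bound rules out [::], [:: x] and [:: x; y], which ucycle may accept. *)
Definition hamilton_cycle (T : finType) (e : rel T) (s : seq T) : Prop :=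
  [/\ ucycle e s, size s = #|T| & (3 <= size s)%N].

Definition cycle_edges (T : finType) (s : seq T) : {set {set T}} :=
  [set [set x; next s x] | x in s].

(* H is the edge set of the coloured graph. A colouring is a total function on
   {set T}, but only its values on the members of H matter; so a colouring of
   the edges of a graph restricts to any subgraph without further ado. *)
Definition unbalanced (T : finType) (r t : nat) (H : {set {set T}})
    (c : {set T} -> 'I_r) : Prop :=
  exists i : 'I_r,
    #|H|%:R / r%:R + t%:R <= #|[set f in H | c f == i]|%:R :> rat.

(* Main.v *)
Require Import Defs.
From mathcomp Require Import all_boot all_order all_algebra.
From mathcomp Require Import zify ring.

Set Implicit Arguments.
Unset Strict Implicit.
Unset Printing Implicit Defensive.

Import Order.TTheory GRing.Theory Num.Theory.
Local Open Scope ring_scope.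

(* Call (v, ab, cd) a gadget if vab and vcd are triangles, the edges ab and cd
   share at most one vertex, and moving v from between a and b to between c and
   d in a Hamilton cycle changes the number of edges of some colour i.

   If there are d r^2 vertex-disjoint gadgets, then d r of them lose the same
   colour i. By a rotation argument some Hamilton cycle H passes through all of
   these; moving the d r vertices gives a Hamilton cycle H' with at least d r
   fewer edges of colour i. Either H has many edges of colour i, or H' has few,
   and then by averaging H' has many edges of some other colour.

   Otherwise some set U of at most 5 d r^2 vertices meets every gadget. Outside
   U the vector [va] + [vb] - [ab] (where [xy] is the indicator vector of the
   colour of xy) is the same for all triangles vab at a given v; call it f(v),
   so that 2 [ab] = f(a) + f(b). Some coordinate z of f is odd at one vertex,
   hence everywhere, hence it is 1 or -1. The vertices with value -1 form an
   independent set A, of size at most n - delta, and all edges avoiding A and U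
   have colour z. Thus every Hamilton cycle has at least 2 delta - n - 2 |U|
   edges of colour z. *)

(** * Weights of cyclic sequences *)

Section CycleWeight.
Local Open Scope nat_scope.
Variable T : finType.
Implicit Types (g : T -> T -> nat) (s p q : seq T).

Definition symw g := forall x y, g x y = g y x.

Definition pw g x p := sumn (pairmap g x p).

(* Sum of g over the cyclically consecutive pairs of s. *)
Definition cw g s := if s is x :: p then g (last x p) x + pw g x p else 0.

Lemma pw_cat g x p q : pw g x (p ++ q) = pw g x p + pw g (last x p) q.
Proof. by rewrite /pw pairmap_cat sumn_cat. Qed.

Lemma cw_rot g k s : cw g (rot k s) = cw g s.
Proof.
have cw_rcons x p : cw g (rcons p x) = cw g (x :: p).
  case: p => [//|y p] /=.
  by rewrite last_rcons -cats1 pw_cat /pw /=; lia.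
elim: k s => [|k IHk] s; first by rewrite rot0.
have [lt_ks|le_sk] := ltnP k (size s); last by rewrite rot_oversize // ltnW.
rewrite -add1n rotD ?add1n // -[RHS]IHk.
by case: (rot k s) => [|x p]; rewrite ?rot1_cons.
Qed.

Lemma pw_rev g x p : symw g ->
  pw g (last x p) (rev (belast x p)) = pw g x p.
Proof.
move=> gC; elim: p x => [//|y p IHp] x.
rewrite /= rev_cons -cats1 pw_cat IHp /pw /= addn0 addnC; congr (_ + _).
by rewrite gC; congr (g _ _); case: p {IHp} => //= z p; rewrite rev_cons last_rcons.
Qed.

Lemma pw_ltP f g x p : pw f x p < pw g x p ->
  exists p1 y p2, p = p1 ++ y :: p2 /\ f (last x p1) y < g (last x p1) y.
Proof.
elim: p x => [//|y p IHp] x; rewrite /pw /= => lt_fg.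
have [lt1|le1] := ltnP (f x y) (g x y); first by exists [::], y, p.
have [|p1 [z [p2 [-> lt_z]]]] := IHp y; first by rewrite /pw; lia.
by exists (y :: p1), z, p2.
Qed.

Lemma cw_const k s : cw (fun _ _ => k) s = k * size s.
Proof.
case: s => [|x p] /=; first by rewrite muln0.
rewrite mulnS; congr (_ + _).
by elim: p x => [|y p IHp] x /=; rewrite /pw /= ?muln0 // mulnS -(IHp y).
Qed.

(** Averaging, with the pair found rotated into closing position. For [f] zero it locates a pair of
    positive weight. *)
Lemma cw_ltP f g s : cw f s < cw g s ->
  exists k y p, rot k s = y :: p /\ f (last y p) y < g (last y p) y.
Proof.
case: s => [//|x p] /= lt_fg.
have [lt1|le1] := ltnP (f (last x p) x) (g (last x p) x).
  by exists 0, x, p; rewrite rot0.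
have [|p1 [y [p2 [-> lt_y]]]] := @pw_ltP f g x p; first by lia.
exists (size (x :: p1)), y, (p2 ++ x :: p1); split.
  by rewrite -cat_cons rot_size_cat.
by rewrite last_cat.
Qed.

(* For uniq s with size s > 2, cw (link x y) s tells whether xy is an edge of
   the cycle s. *)
Definition link x y (u w : T) : nat := [set u; w] == [set x; y].

Lemma linkC x y u w : link x y u w = link x y w u.
Proof. by rewrite /link setUC. Qed.

Lemma link_sym x y u w : link x y u w = link y x u w.
Proof. by rewrite /link (setUC [set y]). Qed.

Lemma linkP x y u w : 0 < link x y u w -> (u = x /\ w = y) \/ (u = y /\ w = x).
Proof.
rewrite lt0b => /eqP/setP E.
have := E x; have := E y; have := E u; have := E w; rewrite !inE !eqxx !orbT.
move=> /esym/orP[]/eqP-> /esym/orP[]/eqP->.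
- by rewrite orbb => /eqP-> _; auto.
- by auto.
- by auto.
- by move=> _; rewrite orbb => /eqP->; auto.
Qed.

Lemma linkxx x y : link x y x y = 1.
Proof. by rewrite /link eqxx. Qed.

Lemma link0 x y u w : (u \notin [:: x; y]) -> link x y u w = 0.
Proof.
move=> Nu; case E: (link x y u w) => [//|m].
have /linkP H : 0 < link x y u w by rewrite E.
by case: H Nu => [] [-> _]; rewrite !inE eqxx ?orbT.
Qed.

Lemma cw_link s1 x y s2 : 0 < cw (link x y) (s1 ++ x :: y :: s2).
Proof.
case: s1 => [|z s1] /=; first by rewrite /pw /= linkxx; lia.
by rewrite pw_cat /pw /= linkxx; lia.
Qed.

(** One [s'] serves every [g], so that the same identity tracks non-edges, colours and links. *)
Lemma cw_insert v c d s : 0 < cw (link c d) s ->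
  exists2 s', perm_eq s' (v :: s) &
    forall g, symw g -> cw g s' + g c d = cw g s + g v c + g v d.
Proof.
have cw0 : cw (fun _ _ => 0) s = 0 by rewrite cw_const mul0n.
rewrite -{1}cw0 => /cw_ltP[k [y [p [Es /linkP yP]]]].
exists (v :: y :: p); first by rewrite perm_cons -Es perm_rot.
move=> g gC; rewrite -(cw_rot g k s) Es /= /pw /=.
by case: yP => [[-> ->]|[-> ->]]; rewrite (gC _ v) ?(gC d c); lia.
Qed.

Lemma pw_link0 v a x p : v \notin x :: p -> pw (link a v) x p = 0.
Proof.
elim: p x => [//|y p IHp] x; rewrite inE negb_or => /andP[Nx Ny].
rewrite /pw /= -/(pw _ y p) IHp // addn0.
case E: (link a v x y) => [//|m].
have /linkP[[_ Ey]|[Ex _]] : 0 < link a v x y by rewrite E.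
  by rewrite -Ey inE eqxx in Ny.
by rewrite Ex eqxx in Nx.
Qed.

(** Since [v] occurs once, a link at [v] joins it to a cyclic neighbour; [a] and [b], being
    distinct, are the two neighbours. *)
Lemma cw_remove v a b s : uniq s -> v \in s -> a != v -> b != v -> a != b ->
    0 < cw (link a v) s -> 0 < cw (link b v) s ->
  exists2 s', perm_eq s (v :: s') &
    forall g, symw g -> cw g s + g a b = cw g s' + g v a + g v b.
Proof.
move=> Us /rot_to[k q Es] av bv ab.
rewrite -!(cw_rot _ k s) Es.
have: uniq (v :: q) by rewrite -Es rot_uniq.
case: q Es => [|w q] Es.
  move=> _ /=; rewrite /pw /= addn0 => /linkP[[va _]|[_ va]].
    by rewrite va eqxx in av.
  by rewrite va eqxx in av.
rewrite cons_uniq => /andP[Nv Uq].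
have H x : x != v -> 0 < cw (link x v) (v :: w :: q) -> x = w \/ x = last w q.
  move=> xv; rewrite /= /pw /= -/(pw _ w q) pw_link0 // addn0 addn_gt0.
  case/orP => /linkP[[E1 E2]|[E1 E2]].
  - by right.
  - by rewrite E2 eqxx in xv.
  - by rewrite E1 eqxx in xv.
  - by left.
move=> /(H a av) Ha /(H b bv) Hb.
exists (w :: q); first by rewrite -Es perm_sym perm_rot.
move=> g gC; rewrite -(cw_rot g k s) Es /= /pw /= (gC _ v).
case: Ha => Ha; case: Hb => Hb; move: ab; rewrite Ha Hb ?eqxx // => _;
rewrite ?(gC (last w q) w);
move: (g v (last w q)) (g v w) (sumn _) (g w (last w q)) => *; lia.
Qed.

Lemma cw_move v a b c d s :
    uniq s -> v \in s -> uniq [:: a; v; b] -> v \notin [:: c; d] ->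
    0 < cw (link a v) s -> 0 < cw (link v b) s -> 0 < cw (link c d) s ->
  exists2 s', perm_eq s' s & forall g, symw g ->
    cw g s' + (g v a + g v b + g c d) = cw g s + (g v c + g v d + g a b).
Proof.
move=> Us sv Uv Nv La Lb Lc.
move: Uv => /and3P[]; rewrite !inE negb_or => /andP[av ab] vb _.
have Lb' : 0 < cw (link b v) s.
  suff <- : cw (link v b) s = cw (link b v) s by [].
  case: (s) => [//|x p] /=; rewrite link_sym; congr (_ + sumn _).
  by elim: p x {Us sv La Lb Lc} => //= y p IHp x; rewrite IHp link_sym.
have bv : b != v by rewrite eq_sym.
have [s1 Es1 H1] := cw_remove Us sv av bv ab La Lb'.
have [|s2 Es2 H2] := @cw_insert v c d s1.
   (* Removing [v] keeps the link [cd], because neither end is [v]. *)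
   have := H1 _ (linkC c d); rewrite !(@link0 c d v) // !addn0 => <-.
  exact: leq_trans (leq_addr _ _).
exists s2; first by rewrite (perm_trans Es2) // perm_sym.
by move=> g gC; have := H1 g gC; have := H2 g gC; lia.
Qed.

End CycleWeight.

(** * Rotations and Hamilton cycles *)

Section Hamilton.
Local Open Scope nat_scope.
Variable T : finType.
Implicit Types (g : T -> T -> nat) (s p q : seq T).

Lemma pw_right (h : pred T) x p : pw (fun _ y => h y) x p = count h p.
Proof. by elim: p x => //= y p IHp x; rewrite -(IHp y). Qed.

Lemma pw_left (h : pred T) x p : pw (fun y _ => h y) x p = count h (belast x p).
Proof. by elim: p x => //= y p IHp x; rewrite -(IHp y). Qed.

Lemma pw_add f g x p : pw (fun y z => f y z + g y z) x p = pw f x p + pw g x p.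
Proof. by elim: p x => //= y p IHp x; rewrite /pw /= -!/(pw _ _ _) IHp addnACA. Qed.

Lemma pw_const k x p : pw (fun _ _ : T => k) x p = k * size p.
Proof.
by have /eqP := cw_const k (x :: p); rewrite /= mulnS eqn_add2l => /eqP.
Qed.

Lemma cw_add f g s : cw (fun y z => f y z + g y z) s = cw f s + cw g s.
Proof. by case: s => [//|x p] /=; rewrite pw_add addnACA. Qed.

Lemma cw_left (h : pred T) s : cw (fun y _ => h y) s = count h s.
Proof.
case: s => [//|x p]; rewrite [in RHS]lastI -cats1 count_cat /=.
by rewrite pw_left addn0 addnC.
Qed.

Lemma cw_right (h : pred T) s : cw (fun _ y => h y) s = count h s.
Proof. by case: s => [//|x p] /=; rewrite pw_right. Qed.

Lemma eq_cw f g s : f =2 g -> cw f s = cw g s.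
Proof.
move=> fg; case: s => [//|x p] /=; congr (_ + _); first exact: fg.
by elim: p x => [//|y p IHp] x; rewrite /pw /= fg -!/(pw _ y p) IHp.
Qed.

Lemma cw_sum (I : Type) (r : seq I) (f : I -> T -> T -> nat) s :
  cw (fun y z => \sum_(i <- r) f i y z) s = \sum_(i <- r) cw (f i) s.
Proof.
elim: r => [|i r IHr].
  rewrite big_nil (@eq_cw _ (fun _ _ => 0)) ?cw_const // => x y.
  by rewrite big_nil.
rewrite big_cons -IHr -cw_add; apply: eq_cw => x y.
by rewrite big_cons.
Qed.

(** Only the two pairs at the ends of the reversed segment change; by symmetry the inner pairs keep
    their weight. *)
Lemma cw_reverse g x p1 y p2 : symw g ->
  cw g (x :: p1 ++ rev (y :: p2)) + (g (last y p2) x + g (last x p1) y) =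
  cw g (x :: p1 ++ y :: p2) + (g y x + g (last x p1) (last y p2)).
Proof.
move=> gC; rewrite (lastI y p2) rev_rcons -(lastI y p2) /= !pw_cat !last_cat /=.
rewrite /pw /= -!/(pw _ _ _) pw_rev //.
have -> : last (last y p2) (rev (belast y p2)) = y.
  by case: p2 => //= z p2; rewrite rev_cons last_rcons.
lia.
Qed.

Lemma count_full (a : pred T) s : perm_eq s (enum T) -> count a s = #|a|.
Proof. by move/permP->; rewrite cardE -size_filter enumT. Qed.

Lemma sum_next g s : uniq s -> \sum_(x <- s) g x (next s x) = cw g s.
Proof.
case: s => [|x p]; first by rewrite big_nil.
suff H z y q : uniq (y :: q) ->
    \sum_(u <- y :: q) g u (next_at u z y q) = pw g y q + g (last y q) z.
  by move=> Up; rewrite /= addnC -H.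
elim: q y => [|w q IHq] y Uq; first by rewrite big_seq1 /= eqxx.
rewrite big_cons /= eqxx /pw /= -/(pw _ _ _) -addnA; congr (_ + _).
case/andP: Uq => Ny Uq; rewrite -IHq //.
rewrite [LHS]big_seq_cond [RHS]big_seq_cond; apply: eq_bigr => u /andP[qu _].
by rewrite /= ifN //; apply: contraNneq Ny => <-.
Qed.

(** Distinct vertices with the same outgoing edge would be each other's successor, which three or
    more vertices exclude. *)
Lemma next_edge_inj s : uniq s -> 3 <= size s ->
  {in s &, injective (fun x => [set x; next s x])}.
Proof.
move=> Us s3 x y sx sy E; have [//|xy] := eqVneq x y.
have /linkP[[-> //]|[Ex Ey]] : 0 < link y (next s y) x (next s x).
  by rewrite /link E eqxx.
have: next s (next s x) = x by rewrite Ey.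
have [k q Es] := rot_to sx.
rewrite -(next_rot k Us) -(next_rot k Us) Es.
have: uniq (x :: q) by rewrite -Es rot_uniq.
have: 3 <= size (x :: q) by rewrite -Es size_rot.
case: q {Es} => [//|u [//|w q]] _ /and3P[].
rewrite !inE !negb_or => /and3P[xu xw _] /andP[uw _] _ /=.
by rewrite eqxx (eq_sym u x) (negPf xu) eqxx => Ewx; rewrite Ewx eqxx in xw.
Qed.

Lemma card_cycle_edges (P : pred {set T}) s : uniq s -> 3 <= size s ->
  #|[set f in cycle_edges s | P f]| = cw (fun x y => P [set x; y]) s.
Proof.
move=> Us s3; rewrite -(sum_next _ Us).
have -> : [set f in cycle_edges s | P f] =
    [set [set x; next s x] | x in [set x in s | P [set x; next s x]]].
  apply/setP => f; rewrite inE; apply/andP/imsetP => [[/imsetP[x sx ->] Pf]|].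
    by exists x => //; rewrite inE; apply/andP.
  by case=> x; rewrite inE => /andP[sx Px] ->; split=> //; apply/imsetP; exists x.
rewrite card_in_imset => [|x y]; last first.
  by rewrite !inE => /andP[sx _] /andP[sy _]; apply: next_edge_inj.
rewrite -big_mkcond /= sum1_count -size_filter -(card_uniqP (filter_uniq _ Us)).
by apply: eq_card => x; rewrite inE mem_filter andbC.
Qed.

Variables (e : rel T) (esym : symmetric e) (eirr : irreflexive e).

Lemma min_degree_le x : min_degree e <= degree e x.
Proof.
rewrite /min_degree; have := mem_index_enum x.
elim: (index_enum T) => [//|y r IHr]; rewrite big_cons inE geq_min.
by case/orP => [/eqP->|/IHr->]; rewrite ?leqnn ?orbT.
Qed.

Definition nonedge x y : nat := ~~ e x y.

Lemma nonedgeC : symw nonedge.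
Proof. by move=> x y; rewrite /nonedge esym. Qed.

Lemma cw_hamilton s : perm_eq s (enum T) -> 3 <= #|T| -> cw nonedge s = 0 ->
  hamilton_cycle e s.
Proof.
move=> Es T3 s0; have Us : uniq s by rewrite (perm_uniq Es) enum_uniq.
have sz : size s = #|T| by rewrite (perm_size Es) cardE.
split; rewrite ?sz // /ucycle Us andbT.
case: s s0 {Es Us sz} => [//|x p] /=.
move=> /eqP; rewrite addn_eq0 => /andP[/eqP e0 /eqP p0].
rewrite rcons_path; apply/andP; split; last first.
  by move: e0; rewrite /nonedge; case: (e _ _).
elim: p x {e0} p0 => [//|y p IHp] x /eqP; rewrite /pw /= addn_eq0 -/(pw _ y p).
by case/andP=> e0 /eqP/IHp->; move: e0; rewrite /nonedge; case: (e _ _).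
Qed.

(* With x and y the ends of a non-edge of the cycle, some consecutive pair u, w
   satisfies u ~ y, w ~ x and u \notin Z; the segment from w to y is reversed. *)
Lemma rotation_step (Z : {set T}) s :
    #|Z| + #|T| <= 2 * min_degree e -> perm_eq s (enum T) -> 0 < cw nonedge s ->
  exists s', [/\ perm_eq s' (enum T), cw nonedge s' < cw nonedge s &
    forall x y, x \in Z -> y \in Z -> e x y -> cw (link x y) s <= cw (link x y) s'].
Proof.
move=> Zd Es.
have cw0 : cw (fun _ _ : T => 0) s = 0 by rewrite cw_const.
rewrite -{1}cw0 => /cw_ltP[k [x [p [Ek]]]].
set y := last x p => yx.
have Ep : perm_eq (x :: p) (enum T) by rewrite -Ek perm_rot.
have Nyx : ~~ e y x by move: yx; rewrite /nonedge; case: (e y x).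
have degx z : #|[pred u | e u z]| = degree e z.
  by rewrite /degree -cardsE; apply: eq_card => u; rewrite !inE esym.
(* The left sum is at most |T| - 1 + |Z|, the right one is deg x + deg y. A pair where the right is
   larger has both adjacencies and its first vertex outside [Z]. *)
have: pw (fun u _ => 1 + (u \in Z)) x p < pw (fun u w => e w x + e u y) x p.
  rewrite !pw_add pw_const.
  rewrite (pw_right (fun u => e u x)) (pw_left (fun u => e u y)) (pw_left (mem Z)).
  have := count_full (fun u => e u x) Ep; rewrite /= eirr add0n => ->.
  have := count_full (fun u => e u y) Ep.
  rewrite lastI -cats1 count_cat /= -/y eirr !addn0 => ->.
  have := count_full (mem Z) Ep; rewrite lastI -cats1 count_cat /= => cZ.
  have cT : (size p).+1 = #|T| by rewrite cardE -(perm_size Ep).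
  have := min_degree_le x; have := min_degree_le y => dy dx.
  have -> : #|fun u => e u x| = degree e x := degx x.
  have -> : #|fun u => e u y| = degree e y := degx y.
  have : count (mem Z) (belast x p) <= #|Z|.
    by rewrite -[#|Z|]/(#|mem Z|) -cZ leq_addr.
  move: Zd; rewrite -cT; move: #|Z| => z; move: (count _ _) => q; lia.
case/pw_ltP => p1 [w [p2 [Dp lt2]]].
have [wx uy NuZ] : [/\ e w x, e (last x p1) y & last x p1 \notin Z].
  by case: (e w x) (e _ y) (_ \in Z) lt2 => [] [] [].
have Ey : last w p2 = y by rewrite /y Dp last_cat.
have E g (gC : symw g) := cw_reverse x p1 w p2 gC.
exists (x :: p1 ++ rev (w :: p2)); split.
- apply: perm_trans Ep; rewrite Dp perm_cons perm_cat2l.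
  by rewrite perm_rev.
- have := E _ nonedgeC; rewrite -Dp Ey -(cw_rot _ k s) Ek.
  by rewrite /nonedge uy wx Nyx /=; lia.
- move=> a b Za Zb eab; have := E _ (linkC a b); rewrite -Dp Ey -(cw_rot _ k s) Ek.
  (* Neither removed pair is [ab]: [yx] is a non-edge, and the other has a vertex outside [Z]. *)
  have -> : link a b y x = 0.
    rewrite /link; case: eqP => // Eab; have : 0 < link a b y x by rewrite /link Eab eqxx.
    by move/linkP => [[E1 E2]|[E1 E2]]; rewrite E1 E2 ?eab // esym eab in Nyx.
  rewrite (@link0 _ a b (last x p1) w); last first.
    by rewrite !inE; apply: contra NuZ => /orP[]/eqP->.
  by rewrite !addn0 => ->; apply: leq_addr.
Qed.

(** Rotations come to an end because each lowers the number of non-edges. Empty [Z] is the case of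
    Dirac's theorem. *)
Lemma hamilton_through (Z : {set T}) s :
    #|Z| + #|T| <= 2 * min_degree e -> perm_eq s (enum T) ->
  exists s', [/\ perm_eq s' (enum T), cw nonedge s' = 0 &
    forall x y, x \in Z -> y \in Z -> e x y -> cw (link x y) s <= cw (link x y) s'].
Proof.
move=> Zd; have [m] := ubnP (cw nonedge s).
elim: m s => [//|m IHm] s lt_m Es.
have [s0|] := posnP (cw nonedge s); first by exists s; split.
case/(rotation_step Zd Es) => s1 [Es1 lt1 k1].
have [|s2 [Es2 s20 k2]] := IHm s1 _ Es1; first exact: leq_trans lt1 _.
exists s2; split=> // x y Zx Zy exy.
exact: leq_trans (k1 x y Zx Zy exy) (k2 x y Zx Zy exy).
Qed.

End Hamilton.

(** * Gadgets *)

Lemma ltn_exchange (x y u w : nat) : (x + u = y + w -> w < u -> x < y)%N.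
Proof. lia. Qed.

Lemma odd_exchange (x y z u : nat) : (x + z = y + u -> odd (x + u) = odd (y + z))%N.
Proof. lia. Qed.

Section Gadgets.
Local Open Scope nat_scope.
Variables (T : finType) (e : rel T) (esym : symmetric e) (eirr : irreflexive e).
Variables (r : nat) (col : {set T} -> 'I_r).
Implicit Types (s : seq T) (i : 'I_r).

Definition cost i x y : nat := col [set x; y] == i.

Lemma costC i : symw (cost i).
Proof. by move=> x y; rewrite /cost setUC. Qed.

(* The tuple (v, a, b, c, d) stands for moving v from between a and b to between
   c and d; if the edges ab and cd share a vertex, it is called b = c. *)
Definition gadget := (T * T * T * T * T)%type.
Implicit Types (p : gadget) (L : seq gadget).

(* Listed so that av, vb and cd are consecutive, also when b = c. *)
Definition gverts p : seq T :=
  let: (v, a, b, c, d) := p in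
  [:: a, v, b & if b == c then [:: d] else [:: c; d]].

Lemma mem_gverts v a b c d : gverts (v, a, b, c, d) =i [:: v; a; b; c; d].
Proof.
move=> x; rewrite /gverts; case: (b =P c) => [->|_]; rewrite !inE orbCA //.
by congr [|| _, _ | _]; rewrite orbA orbb.
Qed.

Definition gshape p :=
  let: (v, a, b, c, d) := p in
  [&& e v a, e v b, e v c, e v d, e a b, e c d & uniq (gverts p)].

(** By the identity in [cw_move], moving [v] loses edges of colour [i]. A gain is a loss for the
    reverse move. *)
Definition drops i p :=
  let: (v, a, b, c, d) := p in
  cost i v c + cost i v d + cost i a b < cost i v a + cost i v b + cost i c d.

Definition linked s p :=
  let: (v, a, b, c, d) := p in
  [&& 0 < cw (link a v) s, 0 < cw (link v b) s & 0 < cw (link c d) s].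

Definition hamiltonian s := perm_eq s (enum T) /\ cw (nonedge e) s = 0.

Lemma link0_notin (x y u w : T) : x != u -> x != w -> link x y u w = 0.
Proof.
move=> xu xw; case E: (link x y u w) => [//|m].
have /linkP H : 0 < link x y u w by rewrite E.
by case: H => [[E1 E2]|[E1 E2]]; [rewrite E1 eqxx in xu|rewrite E2 eqxx in xw].
Qed.

(** All pairs involved are edges, so no non-edge arises. The last clause keeps gadgets disjoint from
    [p] linked. *)
Lemma switch i p s : gshape p -> drops i p -> linked s p -> hamiltonian s ->
  exists s', [/\ hamiltonian s', cw (cost i) s' < cw (cost i) s &
    forall x y, x \notin gverts p -> cw (link x y) s <= cw (link x y) s'].
Proof.
case: p => [[[[v a] b] c] d].
move=> /and5P[va vb vc vd /and3P[ab cd Up]] dr /and3P[La Lb Lc] [Es s0].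
have Us : uniq s by rewrite (perm_uniq Es) enum_uniq.
have sv : v \in s by rewrite (perm_mem Es) mem_enum.
have U3 : uniq [:: a; v; b].
  by move: Up; rewrite /gverts -[_ :: _]/([:: a; v; b] ++ _) cat_uniq => /andP[].
have Nv : v \notin [:: c; d].
  rewrite !inE negb_or; apply/andP; split.
    by apply: contraTneq vc => <-; rewrite eirr.
  by apply: contraTneq vd => <-; rewrite eirr.
have [s' Es' H] := cw_move Us sv U3 Nv La Lb Lc.
exists s'; split.
- split; first exact: perm_trans Es' Es.
  have := H _ (nonedgeC esym); rewrite s0 /nonedge va vb vc vd ab cd /=.
  by rewrite !addn0.
- exact: ltn_exchange (H _ (@costC i)) dr.
- move=> x y Nx; have := H _ (linkC x y).
  move: Nx; rewrite mem_gverts !inE !negb_or => /and5P[xv xa xb xc xd].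
  rewrite (link0_notin y xv xa) (link0_notin y xv xb) (link0_notin y xc xd) !addn0 => ->.
  exact: leq_addr.
Qed.

Lemma switch_all i L s : all gshape L -> all (drops i) L ->
    uniq (flatten (map gverts L)) -> all (linked s) L -> hamiltonian s ->
  exists2 s', hamiltonian s' & cw (cost i) s' + size L <= cw (cost i) s.
Proof.
elim: L s => [|p L IHL] s; first by exists s; rewrite ?addn0.
move=> /andP[shp shL] /andP[dp dL] /=.
rewrite cat_uniq => /and3P[_ /hasPn disj UL] /andP[lp lL] hs.
have [s1 [hs1 lt1 k1]] := switch shp dp lp hs.
have lL1 : all (linked s1) L.
  apply/allP => q Lq; have := allP lL _ Lq.
  have Nq x : x \in gverts q -> x \notin gverts p.
    by move=> qx; apply: disj; apply/flattenP; exists (gverts q) => //; apply: map_f.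
  case: q Nq {Lq} => [[[[v a] b] c] d] Nq /and3P[La Lb Lc].
  apply/and3P; split; [apply: leq_trans La _|apply: leq_trans Lb _|apply: leq_trans Lc _];
    by apply: k1; apply: Nq; rewrite mem_gverts !inE eqxx ?orbT.
have [s' hs' le'] := IHL s1 shL dL UL lL1 hs1.
by exists s' => //; rewrite addnS; apply: leq_trans lt1; rewrite ltnS.
Qed.

Lemma size_gverts p : size (gverts p) <= 5.
Proof. by case: p => [[[[v a] b] c] d] /=; case: ifP. Qed.

Lemma size_gverts_flatten L : size (flatten (map gverts L)) <= 5 * size L.
Proof.
elim: L => //= p L IHL; rewrite size_cat mulnS.
exact: leq_add (size_gverts p) IHL.
Qed.

(** The order inside [gverts] makes each required pair consecutive in the concatenation. *)
Lemma linked_flatten L p s : p \in L -> linked (flatten (map gverts L) ++ s) p.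
Proof.
case/splitPr=> L1 L2; rewrite map_cat flatten_cat /= -!catA.
set u := flatten _; set w := flatten _ ++ s.
case: p => [[[[v a] b] c] d] /=; apply/and3P; split.
- exact: cw_link.
- by rewrite -cat_rcons; apply: cw_link.
- rewrite -!cat_rcons; case: eqP => [->|_].
    by rewrite cat_rcons; apply: cw_link.
  by apply: cw_link.
Qed.

(** Listing the gadgets first makes all of them linked; rotations that protect their vertices, at
    most 5 [size L] in number, give a Hamilton cycle, in which the switches are made one by one. *)
Lemma gadgets_gain i L : all gshape L -> all (drops i) L ->
    uniq (flatten (map gverts L)) -> 5 * size L + #|T| <= 2 * min_degree e ->
  exists s s', [/\ hamiltonian s, hamiltonian s' &
    cw (cost i) s' + size L <= cw (cost i) s].
Proof.
move=> shL dL UL big; set f := flatten (map gverts L).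
set rest := [seq x <- enum T | x \notin f].
have Es0 : perm_eq (f ++ rest) (enum T).
  apply: uniq_perm; rewrite ?enum_uniq //.
    rewrite cat_uniq UL filter_uniq ?enum_uniq // andbT /=.
    by apply/hasPn => x; rewrite mem_filter => /andP[].
  by move=> x; rewrite mem_cat mem_filter mem_enum andbT orbN.
have [|s [Es s0 ks]] := hamilton_through esym eirr (Z := [set x in f]) _ Es0.
  apply: leq_trans big; rewrite leq_add2r cardsE.
  exact: leq_trans (card_size _) (size_gverts_flatten L).
have lL : all (linked s) L.
  apply/allP => p Lp; have := @linked_flatten L p rest Lp; have := allP shL _ Lp.
  have Zp x : x \in gverts p -> x \in [set x in f].
    by move=> px; rewrite inE; apply/flattenP; exists (gverts p) => //; apply: map_f.
  rewrite -/f; case: p Zp {Lp} => [[[[v a] b] c] d] Zp.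
  move=> /and5P[va vb vc vd /and3P[ab cd _]] /and3P[La Lb Lc].
  apply/and3P; split; [apply: leq_trans La _|apply: leq_trans Lb _|apply: leq_trans Lc _];
    by apply: ks; rewrite ?(esym a) //; apply: Zp; rewrite mem_gverts !inE eqxx ?orbT.
have [s' hs' le'] := switch_all shL dL UL lL (conj Es s0).
by exists s, s'.
Qed.

Lemma drops_pigeonhole L : 0 < r -> all (fun p => [exists i, drops i p]) L ->
  exists i, size L <= r * size (filter (drops i) L).
Proof.
move=> r0 dL; have [/existsP//|] := boolP [exists i, size L <= r * size (filter (drops i) L)].
rewrite negb_exists => /forallP small.
have sumL : size L <= \sum_i size (filter (drops i) L).
  elim: L dL {small} => //= p L IHL /andP[/existsP[i dp] /IHL le].
  apply: leq_ltn_trans le _; rewrite (bigD1 i) //= [in ltnRHS](bigD1 i) //= dp /=.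
  rewrite addSn ltnS leq_add2l; apply: leq_sum => j _.
  by case: ifP => //=.
have lt i : r * size (filter (drops i) L) <= (size L).-1.
  by have := small i; rewrite -ltnNge; case: (size L) => // m; rewrite ltnS.
have: r * \sum_i size (filter (drops i) L) <= r * (size L).-1.
  rewrite big_distrr /= -[leqRHS]/(muln r (size L).-1).
  have <- : \sum_(i < r) (size L).-1 = r * (size L).-1.
    by rewrite sum_nat_const card_ord.
  by apply: leq_sum => i _; apply: lt.
rewrite leq_pmul2l // => /(leq_trans sumL).
have := small (Ordinal r0); rewrite -ltnNge => pos.
by case: (size L) pos => //= m _; rewrite ltnn.
Qed.

Definition gadgetb p := gshape p && [exists i, drops i p].

(** The vertices of a disjoint family that cannot be enlarged meet every gadget, and each member has
    at most five. *)
Lemma disjoint_gadgets k :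
  (exists L, [/\ size L = k, all gadgetb L & uniq (flatten (map gverts L))]) \/
  (exists2 U : {set T}, #|U| <= 5 * k & forall p, gadgetb p -> has (mem U) (gverts p)).
Proof.
elim: k => [|k [[L [sL gL UL]]|[U cU hU]]]; first by left; exists [::].
- pose U := [set x in flatten (map gverts L)].
  have [/existsP[p /andP[gp Np]]|] := boolP [exists p, gadgetb p && ~~ has (mem U) (gverts p)].
    left; exists (p :: L); split; rewrite /= ?sL ?gp //.
    rewrite cat_uniq UL andbT; apply/andP; split.
      by case: p gp {Np} => [[[[v a] b] c] d] /andP[/and5P[_ _ _ _ /and3P[_ _ ->]]].
    apply: contra Np => /hasP[x Lx px]; apply/hasP; exists x => //.
    by rewrite /= inE.
  rewrite negb_exists => /forallP hit; right; exists U.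
    rewrite cardsE; apply: leq_trans (card_size _) _.
    by apply: leq_trans (size_gverts_flatten L) _; rewrite sL leq_mul2l leqnSn orbT.
  by move=> p gp; have := hit p; rewrite gp negbK.
- by right; exists U => //; apply: leq_trans cU _; rewrite leq_mul2l leqnSn orbT.
Qed.

(** Inclusion-exclusion gives at least 2 delta - |T| common neighbours. The case [x = y] supplies a
    neighbour of [x] outside [U]. *)
Lemma common_neighbour (U : {set T}) x y : #|U| + #|T| < 2 * min_degree e ->
  exists2 w, w \notin U & e x w /\ e y w.
Proof.
move=> lt; pose N := [set w | e x w] :&: [set w | e y w].
have : #|U| < #|N|.
  have := cardsUI [set w | e x w] [set w | e y w].
  have := max_card (mem ([set w | e x w] :|: [set w | e y w])).
  have := min_degree_le e x; have := min_degree_le e y; rewrite /degree -/N.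
  by move: lt; do ![move: #|_|] => *; lia.
move=> ltUN; have /subsetPn[w Nw Uw] : ~~ (N \subset U).
  by apply: contraL ltUN => /subset_leq_card; rewrite -leqNgt.
by exists w => //; move: Nw; rewrite !inE => /andP.
Qed.

(** * Colourings whose gadgets all meet a small set *)

Section Structure.
Variable U : {set T}.
Hypothesis cU : #|U| + #|T| < 2 * min_degree e.
Hypothesis hU : forall p, gadgetb p -> has (mem U) (gverts p).

Definition tri v a b :=
  [&& v \notin U, a \notin U, b \notin U & [&& e v a, e v b & e a b]].

Lemma edge_neq x y : e x y -> x != y.
Proof. by apply: contraTneq => ->; rewrite eirr. Qed.

Lemma triangle x y : x \notin U -> y \notin U -> e x y -> exists u, tri x y u.
Proof.
move=> Ux Uy exy; have [u Uu [xu yu]] := common_neighbour x y cU.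
by exists u; apply/and4P; split=> //; apply/and3P.
Qed.

Lemma tri_swap v a b : tri v a b -> tri v b a.
Proof.
by move=> /and4P[Uv Ua Ub /and3P[va vb ab]]; apply/and4P; split=> //; rewrite vb va (esym b a) ab.
Qed.

Lemma tri_rot v a b : tri v a b -> tri a v b.
Proof.
by move=> /and4P[Uv Ua Ub /and3P[va vb ab]]; apply/and4P; split=> //; rewrite (esym a v) va ab vb.
Qed.

Lemma no_gadget i v a b c d : tri v a b -> tri v c d ->
  uniq (gverts (v, a, b, c, d)) -> ~~ drops i (v, a, b, c, d).
Proof.
move=> /and4P[Uv Ua Ub /and3P[va vb ab]] /and4P[_ Uc Ud /and3P[vc vd cd]] Up.
apply/negP => dp; have /hasP[x] : has (mem U) (gverts (v, a, b, c, d)).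
  apply: hU; rewrite /gadgetb /gshape va vb vc vd ab cd Up /=.
  by apply/existsP; exists i.
rewrite mem_gverts !inE => + Ux.
by do ![case/orP]; move=> /eqP Ex; move: Ux; rewrite /= Ex; apply/negP.
Qed.

(** A violation gives a gadget avoiding [U]. A shared vertex must be called [b = c], whence the
    swaps within the pairs; if the two pairs coincide, both sides agree. *)
Lemma consistent_le i v a b c d : tri v a b -> tri v c d ->
  cost i v a + cost i v b + cost i c d <= cost i v c + cost i v d + cost i a b.
Proof.
move=> t1 t2; rewrite leqNgt; apply/negP => D.
have /and4P[_ _ _ /and3P[/edge_neq va /edge_neq vb /edge_neq ab]] := t1.
have /and4P[_ _ _ /and3P[/edge_neq vc /edge_neq vd /edge_neq cd]] := t2.
have t1' : tri v b a by exact: tri_swap.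
have t2' : tri v d c by exact: tri_swap.
have D1 : drops i (v, b, a, c, d).
  by rewrite /drops (costC i b a) (addnC (cost i v b)).
have D2 : drops i (v, b, a, d, c).
  by rewrite /drops (costC i b a) (addnC (cost i v b)) (addnC (cost i v d)) (costC i d c).
have D3 : drops i (v, a, b, d, c).
  by rewrite /drops (addnC (cost i v d)) (costC i d c).
have av : (a == v) = false by rewrite eq_sym (negPf va).
have bv : (b == v) = false by rewrite eq_sym (negPf vb).
have ba : (b == a) = false by rewrite eq_sym (negPf ab).
move: va vb ab vc vd cd => /negPf va /negPf vb /negPf ab /negPf vc /negPf vd /negPf cd.
have [Eac|/negPf ac] := eqVneq a c.
  have [Ebd|/negPf bd] := eqVneq b d; first by move: D; rewrite Eac Ebd ltnn.
  have := no_gadget i t1' t2; rewrite D1 /gverts -Eac eqxx /= !inE.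
  by rewrite bv ba bd va vd Eac cd => /(_ isT).
have [Ead|/negPf ad] := eqVneq a d.
  have [Ebc|/negPf bc] := eqVneq b c.
    by move: D; rewrite Ead Ebc (costC i c d) (addnC (cost i v d)) ltnn.
  have := no_gadget i t1' t2'; rewrite D2 /gverts -Ead eqxx /= !inE.
  by rewrite bv ba bc va vc ac => /(_ isT).
have [Ebc|/negPf bc] := eqVneq b c.
  have := no_gadget i t1 t2; rewrite /drops D /gverts -Ebc eqxx /= !inE.
  by rewrite av ab ad vb vd Ebc cd => /(_ isT).
have [Ebd|/negPf bd] := eqVneq b d.
  have := no_gadget i t1 t2'; rewrite D3 /gverts -Ebd eqxx /= !inE.
  by rewrite av ab ac vb vc bc => /(_ isT).
have := no_gadget i t1 t2; rewrite /drops D /gverts bc /= !inE.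
by rewrite av ab ac ad vb vc vd bc bd cd => /(_ isT).
Qed.

(** This makes f(v) = [va] + [vb] - [ab] well defined, with the negative terms moved across. *)
Lemma consistent i v a b c d : tri v a b -> tri v c d ->
  cost i v a + cost i v b + cost i c d = cost i v c + cost i v d + cost i a b.
Proof. by move=> t1 t2; apply/eqP; rewrite eqn_leq !consistent_le. Qed.

(** The parity of the coordinate [z] of f(v). Written with positive signs it is symmetric in the
    three vertices. *)
Definition oddtri z v a b := odd (cost z v a + cost z v b + cost z a b).

(** The counts over all colours sum to three, so one of them is odd. *)
Lemma exists_odd v a b : exists z, oddtri z v a b.
Proof.
rewrite /oddtri /cost.
set p := col [set v; a]; set q := col [set v; b]; set s := col [set a; b].
have [->|pq] := eqVneq p q; first by exists s; rewrite eqxx; case: (q == s).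
have [->|sp] := eqVneq s p.
  by exists q; rewrite eqxx (negPf pq).
by exists p; rewrite eqxx (negPf sp) eq_sym (negPf pq).
Qed.

(** Consistency makes the parity independent of the triangle at a vertex, a shared triangle passes
    it to a neighbour, and common neighbours connect all vertices outside [U]. *)
Lemma odd_everywhere (x0 : T) : exists z, forall w a b, tri w a b -> oddtri z w a b.
Proof.
have [v Uv _] := common_neighbour x0 x0 cU.
have [v1 Uv1 [vv1 _]] := common_neighbour v v cU.
have [v2 t0] := triangle Uv Uv1 vv1.
have [z oz] := exists_odd v v1 v2; exists z.
have same u a b c d : tri u a b -> tri u c d -> oddtri z u a b -> oddtri z u c d.
  by move=> t1 t2; have := consistent z t1 t2; rewrite /oddtri => /odd_exchange->.
have step u w : u \notin U -> w \notin U -> e u w ->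
    (forall a b, tri u a b -> oddtri z u a b) -> forall a b, tri w a b -> oddtri z w a b.
  move=> Uu Uw uw Hu a b t; have [x tx] := triangle Uu Uw uw.
  apply: same (tri_rot tx) t _; have := Hu _ _ tx; rewrite /oddtri (costC z w u).
  by rewrite addnAC.
have Hv a b : tri v a b -> oddtri z v a b by move=> t; apply: same t0 t oz.
move=> w a b t; have Uw : w \notin U by case/and4P: t.
have [u Uu [vu wu]] := common_neighbour v w cU.
by apply: (step u w) t => //; [rewrite esym|apply: (step v u)].
Qed.

(* A collects the vertices w whose triangles wab have colour z exactly on ab. *)
Lemma structure (x0 : T) : exists (z : 'I_r) (A : {set T}),
  (forall x y, x \in A -> y \in A -> ~~ e x y) /\
  (forall x y, x \notin A :|: U -> y \notin A :|: U -> e x y -> cost z x y = 1).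
Proof.
have [z oz] := odd_everywhere x0; exists z.
pose A := [set w | [exists a, exists b, [&& tri w a b, cost z w a == 0 & cost z a b == 1]]].
have le1 x y : cost z x y <= 1 by rewrite /cost leq_b1.
(* Oddness makes [wb] zero too, so f(w) is -1 at [z]; consistency then forces these values in every
   triangle at [w]. *)
have AP w c d : w \in A -> tri w c d -> cost z w c = 0 /\ cost z c d = 1.
  rewrite inE => /existsP[a /existsP[b /and3P[t /eqP wa /eqP ab]]] t'.
  have := oz _ _ _ t; have := consistent z t t'; rewrite /oddtri wa ab.
  have := le1 w b; have := le1 c d.
  move: (cost z w b) (cost z c d) (cost z w c) (cost z w d) => *; lia.
exists A; split=> [x y Ax Ay|x y].
  (* In a triangle [xyu] the edge [yu] would have colour [z] because [x] is in [A], and another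
     colour because [y] is. *)
  apply/negP => xy.
  have Uout w : w \in A -> w \notin U.
    by rewrite inE => /existsP[a /existsP[b /and3P[/and4P[]]]].
  have [u t] := triangle (Uout x Ax) (Uout y Ay) xy.
  have [_ E1] := AP x y u Ax t.
  have t' : tri y u x by exact/tri_swap/tri_rot.
  by have [E2 _] := AP y u x Ay t'; rewrite E1 in E2.
rewrite !inE !negb_or => /andP[NAx Ux] /andP[NAy Uy] xy.
have [u t] := triangle Ux Uy xy; have := oz _ _ _ t; rewrite /oddtri.
have [->//|ne1] := eqVneq (cost z x y) 1.
have xy0 : cost z x y = 0 by have := le1 x y; case: (cost z x y) ne1 => [|[]].
(* Colour [z] on [yu] would put [x] into [A], and on [xu] it would put [y] into [A]. Without both,
   no edge of the triangle has colour [z], against oddness. *)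
have yu0 : cost z y u = 0.
  have := le1 y u; case E: (cost z y u) => [//|[|//]] _; case/negP: NAx.
  by apply/existsP; exists y; apply/existsP; exists u; rewrite t xy0 E.
have xu0 : cost z x u = 0.
  have := le1 x u; case E: (cost z x u) => [//|[|//]] _; case/negP: NAy.
  by apply/existsP; exists x; apply/existsP; exists u; rewrite tri_rot // costC xy0 E.
by rewrite xy0 xu0 yu0.
Qed.

(** Cycle edges of other colours meet A or [U], and each vertex lies on two cycle edges. Being
    independent, A has at most |T| - delta vertices. *)
Lemma heavy_colour (x0 : T) s : hamiltonian s ->
  exists z, 2 * min_degree e <= cw (cost z) s + #|T| + 2 * #|U|.
Proof.
move=> [Es s0]; have [z [A [indep out]]] := structure x0; exists z.
have cA : min_degree e + #|A| <= #|T|.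
  have [->|[x Ax]] := set_0Vmem A.
    by rewrite cards0 addn0 (leq_trans (min_degree_le e x0)) // max_card.
  rewrite -(cardsC A) addnC leq_add2l; apply: leq_trans (min_degree_le e x) _.
  apply: subset_leq_card; apply/subsetP => y; rewrite !inE => xy.
  by apply: contraL xy; apply: indep.
pose B := A :|: U.
have le_n : #|T| <= cw (cost z) s + 2 * #|B|.
  have <- : cw (fun _ _ => 1) s = #|T| by rewrite cw_const mul1n (perm_size Es) cardE.
  (* Every consecutive pair gets weight at least one: it is a non-edge, has colour [z], or meets
     [B]. *)
  have <- : cw (fun x y => nonedge e x y + (cost z x y + ((x \in B) + (y \in B)))) s
     = cw (cost z) s + 2 * #|B|.
    rewrite !cw_add s0 add0n (cw_left (mem B)) (cw_right (mem B)) !(count_full _ Es).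
    by rewrite addnn -mul2n.
  rewrite leqNgt; apply/negP => /cw_ltP[k [y [p [_]]]].
  rewrite ltnS leqn0 !addn_eq0 => /and4P[/eqP xy /eqP cxy].
  rewrite !eqb0 => xB yB; have := out _ _ xB yB; rewrite cxy => H.
  by move: xy; rewrite /nonedge; case: (e _ _) H => // /(_ isT).
have cB : #|B| <= #|A| + #|U| by rewrite cardsU leq_subr.
by move: cA le_n cB; move: #|A| #|B| #|U| => *; lia.
Qed.

End Structure.
End Gadgets.

(** * Averaging over the colours and choice of constants *)

Section Main.
Local Open Scope nat_scope.
Variables (T : finType) (e : rel T) (r : nat) (col : {set T} -> 'I_r).

Lemma min_degree_le_card : min_degree e <= #|T|.
Proof.
rewrite /min_degree; elim/big_ind: _ => // [m k le_m _|x _].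
  by rewrite geq_min le_m.
exact: max_card.
Qed.

Lemma sum_cost s : hamiltonian e s -> \sum_i cw (cost col i) s = #|T|.
Proof.
move=> [Es _]; rewrite -(cw_sum _ (cost col)).
rewrite (@eq_cw _ _ (fun _ _ => 1)) ?cw_const ?mul1n ?(perm_size Es) ?cardE // => x y.
rewrite /cost (bigD1 (col [set x; y])) //= eqxx big1 // => i ne.
by rewrite eq_sym (negPf ne).
Qed.

(** If [i] misses the target in [s], then in [s'] it has fewer than |T|/r - (r - 1) d edges, so the
    other r - 1 colours average more than |T|/r + d. *)
Lemma biased_after_switch d m i s s' :
    0 < r -> d * r <= m -> hamiltonian e s' ->
    cw (cost col i) s' + m <= cw (cost col i) s ->
  #|T| + r * d <= r * cw (cost col i) s \/
  exists j, #|T| + r * d <= r * cw (cost col j) s'.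
Proof.
move=> r0 drm hs' gain.
have [?|lt_i] := leqP (#|T| + r * d) (r * cw (cost col i) s); first by left.
have [/existsP|] := boolP [exists j, #|T| + r * d <= r * cw (cost col j) s'].
  by right.
rewrite negb_exists => /forallP small; exfalso.
have := sum_cost hs'; rewrite (bigD1 i) //=.
set S := \sum_(_ < _ | _) _ => sumT.
have leS : r * S <= r.-1 * (#|T| + r * d).
  rewrite /S big_distrr /=.
  have <- : \sum_(j < r | j != i) (#|T| + r * d) = r.-1 * (#|T| + r * d).
    by rewrite sum_nat_const (cardC1 i) card_ord.
  by apply: leq_sum => j _; rewrite ltnW // ltnNge small.
move: sumT leS gain lt_i drm; move: #|T| S (cw _ s') (cw _ s) => n S x y.
clear -r0; case: r r0 => // q _ /= sumT leS gain lt_i drm; nia.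
Qed.

Hypotheses (esym : symmetric e) (eirr : irreflexive e).

Lemma biased_hamiltonian d : 1 <= d -> 2 <= r ->
    r.+1 * #|T| + 12 * d * r ^ 3 <= 2 * r * min_degree e ->
  exists s i, [/\ hamiltonian e s, 3 <= #|T| & #|T| + r * d <= r * cw (cost col i) s].
Proof.
move=> d1 r2 deg.
have r0 : 0 < r by apply: ltnW.
have rd0 : 0 < d * r ^ 2 by rewrite muln_gt0 d1 expn_gt0 r0.
have deg' : #|T| + 12 * (d * r ^ 2) <= 2 * min_degree e.
  rewrite -(leq_pmul2l r0); apply: leq_trans _ (_ : 2 * r * min_degree e <= _).
    apply: leq_trans deg; rewrite mulnDr; apply: leq_add; first by rewrite leq_mul2r leqnSn orbT.
    by rewrite !expnS expn0; lia.
  by rewrite mulnCA mulnA.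
(* Since delta is at most |T|, the degree bound forces |T| >= 12 d r^2. *)
have T3 : 3 <= #|T|.
  by move: deg' rd0 min_degree_le_card; move: (d * r ^ 2) (min_degree e) #|T| => *; lia.
(* Pigeonhole over [r] colours leaves at least d r of these gadgets, as the averaging requires. *)
have [[L [sL gL UL]]|[U cU hU]] := disjoint_gadgets e col (d * r ^ 2).
- have shL : all (gshape e) L by apply: sub_all gL => p /andP[].
  have dL : all (fun p => [exists i, drops col i p]) L.
    by apply: sub_all gL => p /andP[].
  have [i] := drops_pigeonhole r0 dL; rewrite sL => big.
  set L' := filter _ L in big.
  have sub : subseq L' L by apply: filter_subseq.
  have UL' : uniq (flatten (map (@gverts T) L')).
    apply: subseq_uniq UL; rewrite /L'; elim: (L) => //= p K IHK.
    case: ifP => _ /=; first exact: cat_subseq.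
    exact: subseq_trans IHK (suffix_subseq _ _).
  have shL' : all (gshape e) L'.
    by rewrite all_filter; apply: sub_all shL => p shp /=; apply/implyP.
  have [|s [s' [hs hs' gain]]] :=
    gadgets_gain esym eirr (L := L') (i := i) shL' (filter_all _ _) UL'.
    have := size_subseq sub; rewrite sL; move: deg'.
    by move: (d * r ^ 2) (size L') (min_degree e) #|T| => *; lia.
  have drm : d * r <= size L'.
    by rewrite -(leq_pmul2l r0) mulnCA mulnn.
  have [win|[j win]] := biased_after_switch r0 drm hs' gain.
    by exists s, i.
  by exists s', j.
- have /card_gt0P[x0 _] : 0 < #|T| by apply: leq_trans T3.
  have [|s [Es s0 _]] := @hamilton_through _ _ esym eirr set0 (enum T) _ (perm_refl _).
    by rewrite cards0; apply: leq_trans deg'; apply: leq_addr.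
  have hs : hamiltonian e s by [].
  have cU' : #|U| + #|T| < 2 * min_degree e.
    by move: cU deg' rd0; move: (d * r ^ 2) #|U| (min_degree e) #|T| => *; lia.
  have [z heavy] := heavy_colour esym eirr cU' hU x0 hs.
  exists s, z; split=> //.
  (* With |U| <= 5 d r^2, r times the count of colour [z] is at least |T| + 12 d r^3 - 10 d r^3,
     which exceeds |T| + r d. *)
  move: deg cU heavy; rewrite !expnS expn0; clear -r0 d1.
  move: #|U| (min_degree e) #|T| (cw _ s) => u m n w *; nia.
Qed.

End Main.

Theorem theorem1p3 (n r d : nat) (hr : (2 <= r)%N) (hd : (1 <= d)%N)
    (T : finType) (e : rel T) (esym : symmetric e) (eirr : irreflexive e)
    (hn : #|T| = n)
    (hdeg : (1 / 2%:R + 1 / (2%:R * r%:R)) * n%:R + 6%:R * d%:R * r%:R ^+ 2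
              <= (min_degree e)%:R :> rat)
    (c : {set T} -> 'I_r) :
  exists s : seq T,
    hamilton_cycle e s /\ unbalanced d (cycle_edges s) c.
Proof.
have r0 : 0 < r%:R :> rat by rewrite ltr0n ltnW.
(* The degree hypothesis times 2r, as an inequality of natural numbers. *)
have deg : (r.+1 * #|T| + 12 * d * r ^ 3 <= 2 * r * min_degree e)%N.
  rewrite -(ler_nat rat) hn !(natrD, natrM, natrX) -natr1.
  rewrite -(ler_pM2l (_ : 0 < 2%:R * r%:R)) ?mulr_gt0 // in hdeg.
  apply: le_trans hdeg; rewrite le_eqVlt; apply/orP; left; apply/eqP; field.
  by rewrite lt0r_neq0.
have [s [i [hs T3 win]]] := biased_hamiltonian c esym eirr hd hr deg.
have [Es s0] := hs.
have Us : uniq s by rewrite (perm_uniq Es) enum_uniq.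
have s3 : (3 <= size s)%N by rewrite (perm_size Es) -cardE.
exists s; split; first exact: cw_hamilton.
have cE : #|cycle_edges s| = #|T|.
  have -> : cycle_edges s = [set f in cycle_edges s | predT f].
    by apply/setP => f; rewrite inE andbT.
  rewrite card_cycle_edges // (@eq_cw _ _ (fun _ _ => 1%N)) //.
  by rewrite cw_const mul1n (perm_size Es) -cardE.
exists i; rewrite cE (card_cycle_edges (fun f => c f == i)) //.
rewrite -(ler_pM2l r0) mulrDr mulrCA divff ?lt0r_neq0 // mulr1.
by rewrite -!natrM -natrD ler_nat.
Qed.
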